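(* Let $U:\mathbb R^d\to[-\infty,\infty)$ be a utility function, with support cone $C_U:=\operatorname{cl}(\operatorname{dom}(U))$ and dual function $U^*$. The following conditions are equivalent: 1. $U$ is asymptotically satiable; 2. $0\in\operatorname{cl}(\operatorname{dom}(U^* ))$; 3. $\operatorname{cl}(\operatorname{dom}(U^* ))=(C_U)^*$; 4. $\operatorname{cl}(\operatorname{dom}(U^* ))$ is a convex cone.
   Context: For a proper concave $U:\mathbb R^d\to[-\infty,\infty)$ (proper: $\operatorname{dom}(U):=\{U>-\infty\}\ne\emptyset$): $\operatorname{cl}(U)$ is the function whose hypograph is the closure of the hypograph of $U$; $\partial U(x)=\{x^*:U(z)\le U(x)+\langle z-x,x^*\rangle\ \forall z\}$; the dual function is the convex function $U^*(x^* )=\sup_{x\in\mathbb R^d}\{U(x)-\langle x,x^*\rangle\}\in(-\infty,\infty]$, with $\operatorname{dom}(U^* )=\{U^*<\infty\}$. A set $C$ is a convex cone if $\lambda C+\mu C\subseteq C$ for all $\lambda,\mu\ge0$; the polar cone of $S$ is $S^*=\{x^*:\langle x,x^*\rangle\ge0\ \forall x\in S\}$. $U$ is a utility function if it is proper concave, $C_U=\operatorname{cl}(\operatorname{dom}(U))$ is a convex cone with $\mathbb R_+^d\subseteq C_U\ne\mathbb R^d$, and $U(x')\ge U(x)$ whenever $x'-x\in C_U$. $U$ is asymptotically satiable if for all $\epsilon>0$ there is $x\in\mathbb R^d$ with $\partial(\operatorname{cl}(U))(x)\cap[0,\epsilon)^d\neq\emptyset$. *)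

(* Defs.v *)
From mathcomp Require Import all_boot all_order all_algebra.
From mathcomp Require Import all_classical all_reals all_analysis.

Set Implicit Arguments.
Unset Strict Implicit.
Unset Printing Implicit Defensive.

Import Order.TTheory GRing.Theory Num.Theory.
Import numFieldNormedType.Exports.

Local Open Scope classical_set_scope.
Local Open Scope ring_scope.

Section Defs.
Context {R : realType} {d : nat}.
Local Notation vec := 'rV[R]_d.

Implicit Types (U : vec -> \bar R) (C : set vec) (x y z : vec).

Definition dot x y : R := \sum_(i < d) x 0 i * y 0 i.

Definition orthant : set vec := [set x | forall i, 0 <= x 0 i].

Definition convex_cone C : Prop :=
  forall (l m : R) x y, 0 <= l -> 0 <= m -> C x -> C y -> C (l *: x + m *: y).

(* The sign is [>=], following the convention used in mathematical finance;
   with [<=] this would be the negative of this cone. *)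
Definition polar_cone C : set vec := [set y | forall x, C x -> 0 <= dot x y].

(* Concave functions take values in [-oo, +oo[, convex ones in ]-oo, +oo]. *)
Definition cdom U : set vec := [set x | (-oo < U x)%E].
Definition vdom (V : vec -> \bar R) : set vec := [set y | (V y < +oo)%E].

(* The right-hand side is never of the form -oo + +oo when U < +oo, and
   -oo is absorbing for multiplication by t and 1 - t since 0 < t < 1. *)
Definition concave_fun U : Prop :=
  forall x y (t : R), 0 < t -> t < 1 ->
    (t%:E * U x + (1 - t)%:E * U y <= U (t *: x + (1 - t) *: y)%R)%E.

Definition proper_concave U : Prop :=
  [/\ forall x, (U x < +oo)%E, concave_fun U & cdom U !=set0].

Definition hypograph U : set (vec * R) := [set p | (p.2%:E <= U p.1)%E].

(* The function whose hypograph is the closure of that of U, see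
   [hypograph_usc_closure]. *)
Definition usc_closure U : vec -> \bar R :=
  fun x => ereal_sup [set t%:E | t in [set t : R | closure (hypograph U) (x, t)]].

Definition superdifferential U x : set vec :=
  [set y | forall z, (U z <= U x + (dot (z - x) y)%:E)%E].

Definition dual_fun U : vec -> \bar R :=
  fun y => ereal_sup [set (U x - (dot x y)%:E)%E | x in [set: vec]].

Definition support_cone U : set vec := closure (cdom U).

Record utility_function U : Prop := UtilityFunction {
  utility_proper_concave : proper_concave U;
  utility_convex_cone : convex_cone (support_cone U);
  utility_orthant : orthant `<=` support_cone U;
  utility_not_full : support_cone U <> [set: vec];
  utility_monotone : forall x x', support_cone U (x' - x) -> (U x <= U x')%E }.

Definition asymptotically_satiable U : Prop :=
  forall eps : R, 0 < eps -> exists x : vec,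
    superdifferential (usc_closure U) x
      `&` [set y | forall i, 0 <= y 0 i < eps] !=set0.

Lemma closure_hypograph_le U x (s t : R) : s <= t ->
  closure (hypograph U) (x, t) -> closure (hypograph U) (x, s).
Proof.
move=> st clt B [[A1 A2] /= [xA1 sA2] AB].
have tA2 : nbhs t [set r | A2 (r - (t - s))].
  have c : {for t, continuous (fun r : R => r - (t - s))}.
    by apply: continuousB; [exact: cvg_id | exact: cvg_cst].
  by apply: c; rewrite opprB addrC subrK.
have [|[y r] [hyr [/= yA1 rA2]]] := clt (A1 `*` [set r | A2 (r - (t - s))]).
  by exists (A1, [set r | A2 (r - (t - s))]).
exists (y, r - (t - s)); split; last exact: AB.
apply: le_trans hyr; rewrite /= lee_fin gerBl subr_ge0 //.
Qed.

Lemma hypograph_usc_closure U :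
  hypograph (usc_closure U) = closure (hypograph U).
Proof.
apply/seteqP; split => -[x t] /=; last first.
  by move=> h; apply: ereal_sup_ubound; exists t.
rewrite /hypograph /= => tle.
have below (e : R) : 0 < e -> closure (hypograph U) (x, t - e).
  move=> e0.
  have : ((t - e)%:E < usc_closure U x)%E.
    by apply: lt_le_trans tle; rewrite lte_fin gtrBl.
  move=> /ereal_sup_gt[_ [r /= hr <-]]; rewrite lte_fin => ltr.
  exact: closure_hypograph_le (ltW ltr) hr.
apply: closed_closure => B [[A1 A2] /= [xA1 tA2] AB].
have [e /= e0 eA2] := tA2.
exists (x, t - e / 2); split; first by apply: below; rewrite divr_gt0.
apply: AB; split => /=; first exact: nbhs_singleton.
apply: eA2 => /=; rewrite opprB addrC subrK gtr0_norm ?divr_gt0//.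
by rewrite ltr_pdivrMr// ltr_pMr// ltr1n.
Qed.

End Defs.

(* Main.v *)
(* Monotonicity of U gives dom(U* ) + (C_U)^* <= dom(U* ) <= (C_U)^*, so the closure
   of dom(U* ) is the polar cone as soon as it contains 0. The link with
   superdifferentials is a proximal argument: U grows at most linearly, hence
   cl(U) - <., y> - (lam/2)|.|^2 attains its maximum at some x, where
   y + lam x is a supergradient of cl(U), hence in dom(U* ). For y = 0 this shows
   that dom(U* ) is nonempty; for y in dom(U* ) near 0, the vector lam x tends to 0
   with lam, which yields arbitrarily small supergradients. *)
Require Import Defs.
From mathcomp Require Import all_boot all_order all_algebra.
From mathcomp Require Import all_classical all_reals all_analysis.
From mathcomp Require Import ring lra.
Import Order.TTheory GRing.Theory Num.Theory.
Import numFieldNormedType.Exports.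
Local Open Scope classical_set_scope.
Local Open Scope ring_scope.

(** * Closures under continuous maps, and the dot product against the sup norm *)

Lemma closure_sub_preimage {S T : topologicalType} (f : S -> T)
    (A : set S) (B : set T) :
  continuous f -> A `<=` f @^-1` B -> closure A `<=` f @^-1` closure B.
Proof.
move=> cf AB x clAx N /cf /clAx[z [Az Nz]].
by exists (f z); split => //; exact: AB.
Qed.

Lemma closure_sub_le {T : topologicalType} {R : realType} (f : T -> R) (c : R)
    (A : set T) :
  continuous f -> (forall x, A x -> f x <= c) -> forall x, closure A x -> f x <= c.
Proof.
move=> cf Ac x /(closure_sub_preimage _ _ [set r | r <= c] cf Ac).
by rewrite /preimage/= -(closure_id _).1//; exact: closed_le.
Qed.

Lemma dotDl {R : realType} {d} (x y z : 'rV[R]_d) : dot (x + y) z = dot x z + dot y z.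
Proof. by rewrite /dot -big_split/=; apply: eq_bigr => i _; rewrite mxE mulrDl. Qed.

Lemma dotZl {R : realType} {d} a (x z : 'rV[R]_d) : dot (a *: x) z = a * dot x z.
Proof. by rewrite /dot mulr_sumr; apply: eq_bigr => i _; rewrite mxE mulrA. Qed.

Lemma dotC {R : realType} {d} (x y : 'rV[R]_d) : dot x y = dot y x.
Proof. by apply: eq_bigr => i _; rewrite mulrC. Qed.

Lemma dotDr {R : realType} {d} (x y z : 'rV[R]_d) : dot z (x + y) = dot z x + dot z y.
Proof. by rewrite dotC dotDl !(dotC z). Qed.

Lemma dotZr {R : realType} {d} a (x z : 'rV[R]_d) : dot z (a *: x) = a * dot z x.
Proof. by rewrite dotC dotZl (dotC z). Qed.

Lemma dotBl {R : realType} {d} (x y z : 'rV[R]_d) : dot (x - y) z = dot x z - dot y z.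
Proof. by rewrite -scaleN1r dotDl dotZl mulN1r. Qed.

Lemma dot_delta_mx {R : realType} {d} (y : 'rV[R]_d) i : dot (delta_mx 0 i) y = y 0 i.
Proof.
rewrite /dot (bigD1 i)//= big1 ?addr0 => [|j ji]; first by rewrite mxE !eqxx mul1r.
by rewrite mxE eqxx (negPf ji) mul0r.
Qed.

Lemma sqr_entry_le_dot {R : realType} {d} (x : 'rV[R]_d) i : x 0 i ^+ 2 <= dot x x.
Proof.
rewrite /dot (bigD1 i)//= expr2 lerDl; apply: sumr_ge0 => j _.
by rewrite -expr2 sqr_ge0.
Qed.

Lemma dot_ge0 {R : realType} {d} (x : 'rV[R]_d) : 0 <= dot x x.
Proof. by apply: sumr_ge0 => j _; rewrite -expr2 sqr_ge0. Qed.

Lemma entry_le_norm {R : realType} {d} (x : 'rV[R]_d) i : `|x 0 i| <= `|x|.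
Proof.
by rewrite [leRHS]/Num.norm/= mx_normrE; exact: (le_bigmax _ _ (0, i)).
Qed.

(** The norm is the sup norm, attained at some entry whose square is one term of [dot x x]. This
    lets the quadratic penalty control the norm. *)
Lemma sqr_norm_le_dot {R : realType} {d} (x : 'rV[R]_d) : `|x| ^+ 2 <= dot x x.
Proof.
have [->|/mx_norm_neq0[[k i]/= xi]] := eqVneq `|x| 0; first by rewrite expr0n dot_ge0.
rewrite [X in X ^+ 2]xi (ord1 k) real_normK ?num_real//.
exact: sqr_entry_le_dot.
Qed.

Lemma dot_le_norm {R : realType} {d} (x y : 'rV[R]_d) :
  `|dot x y| <= `|x| * \sum_i `|y 0 i|.
Proof.
apply: le_trans (ler_norm_sum _ _ _) _; rewrite mulr_sumr; apply: ler_sum => i _.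
by rewrite normrM ler_wpM2r// entry_le_norm.
Qed.

Lemma continuous_dot {R : realType} {d} {T : topologicalType} (f g : T -> 'rV[R]_d) :
  continuous f -> continuous g -> continuous (fun x => dot (f x) (g x)).
Proof.
move=> cf cg; rewrite /dot.
apply: continuous_big => [|i _ x]; first exact: add_continuous.
apply: (@continuousM _ _ (fun x => f x 0 i) (fun x => g x 0 i)).
  exact: (continuous_comp (cf x) (@coord_continuous _ _ _ 0 i (f x))).
exact: (continuous_comp (cg x) (@coord_continuous _ _ _ 0 i (g x))).
Qed.

(** * Concavity and growth on the closed hypograph *)

Lemma hypograph_mix {R : realType} {d} (U : 'rV[R]_d -> \bar R) (t : R) p q :
  concave_fun U -> 0 < t < 1 -> hypograph U p -> hypograph U q ->
  hypograph U (t *: p + (1 - t) *: q).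
Proof.
move=> cU /andP[t0 t1] Up Uq; rewrite /hypograph/=.
apply: le_trans (cU _ _ _ t0 t1); rewrite EFinD !EFinM; apply: leeD.
  by rewrite lee_pmul2l.
by rewrite lee_pmul2l// lte_fin subr_gt0.
Qed.

(** With [q] fixed the combination is a continuous function of [p]. This covers the segments from a
    maximizer [p] in the closure to a point [q] of the hypograph. *)
Lemma closure_hypograph_mix {R : realType} {d} (U : 'rV[R]_d -> \bar R) (t : R) p q :
  concave_fun U -> 0 < t < 1 -> closure (hypograph U) p -> hypograph U q ->
  closure (hypograph U) (t *: q + (1 - t) *: p).
Proof.
move=> cU t01 clp Uq.
pose f p := t *: q + (1 - t) *: p.
have cf : continuous f.
  move=> x; apply: cvgD; first exact: cvg_cst.
  by apply: cvgZr; exact: cvg_id.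
apply: (closure_sub_preimage f _ _ cf _ p clp) => r Ur.
exact: hypograph_mix.
Qed.

(* With [x1 = x0 + (1, .., 1)] and [N = 1 + |x - x1|], the point [w] beyond [x1]
   such that [x1] is a convex combination of [x] and [w] dominates [x0], so
   [U x0 <= U w]; concavity then bounds [U x] in terms of [U x0], [U x1], [N]. *)
Lemma utility_linear_growth {R : realType} {d} (U : 'rV[R]_d -> \bar R) :
  utility_function U -> exists a b, 0 <= b /\
    forall p, closure (hypograph U) p -> p.2 <= a + b * `|p.1|.
Proof.
case=> -[Ufin cU [x0 x0U]] _ orth _ mono.
have finU x : (-oo < U x)%E -> U x = (fine (U x))%:E.
  by move=> Ux; rewrite fineK// fin_numE -ltNye Ux lt_eqF.
pose x1 := x0 + const_mx 1.
have Ux01 : (U x0 <= U x1)%E.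
  by apply: mono; apply: orth => i; rewrite addrAC subrr add0r mxE.
have x1U : (-oo < U x1)%E by exact: lt_le_trans Ux01.
pose s0 := fine (U x0); pose s1 := fine (U x1).
have s01 : s0 <= s1 by rewrite -lee_fin -!finU.
(* Concavity will give [t <= s1 + N * (s1 - s0)]; since [N] is at most one plus the norms of [x] and
   [x1], this splits into the constant and the slope. *)
exists (s1 + (1 + `|x1|) * (s1 - s0)), (s1 - s0); split; first by rewrite subr_ge0.
suff H p : closure (hypograph U) p ->
    p.2 - (s1 - s0) * `|p.1| <= s1 + (1 + `|x1|) * (s1 - s0).
  by move=> p /H; rewrite lerBlDr.
move: p; apply: closure_sub_le.
  move=> p; apply: cvgB; first exact: cvg_snd.
  by apply: cvgMr; apply: cvg_norm; exact: cvg_fst.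
move=> [x t] /= Uxt.
pose N := 1 + `|x - x1|; pose w := x1 - N^-1 *: (x - x1).
have N0 : 0 < N by rewrite ltr_pwDl.
have Uw : hypograph U (w, s0).
  rewrite /hypograph/= -finU//; apply: mono; apply: orth => i.
  have := entry_le_norm (x - x1) i; rewrite /w /x1 !mxE => xi.
  have : N^-1 * (x 0 i - (x0 0 i + 1)) <= 1.
    rewrite ler_pdivrMl// mulr1; apply: le_trans (ler_norm _) _.
    by apply: le_trans xi _; rewrite lerDr.
  lra.
have N10 : 0 < 1 + N by rewrite addr_gt0.
have t01 : 0 < (1 + N)^-1 < 1.
  by rewrite invr_gt0 N10 invf_lt1// ltrDl.
have := hypograph_mix _ _ _ _ cU t01 Uxt Uw; rewrite /hypograph/=.
have -> : (1 + N)^-1 *: x + (1 - (1 + N)^-1) *: w = x1.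
  apply/rowP => i; rewrite /w !mxE; field.
  by rewrite !gt_eqF.
rewrite (finU x1)// lee_fin -/s1 => le1.
have : t + N * s0 <= (1 + N) * s1.
  rewrite -ler_pdivrMl//; apply: le_trans le1; rewrite le_eqVlt; apply/orP; left.
  apply/eqP; rewrite /GRing.scale/=; field.
  by rewrite !gt_eqF.
have Nle : N <= 1 + (`|x| + `|x1|) by rewrite lerD2l ler_normB.
nra.
Qed.

(** * Proximal points and supergradients *)

(** The quadratic penalty beats the linear growth, so the superlevel set [L] is compact. Maximizing
    over pairs in [H] keeps the objective real-valued and continuous. *)
Lemma proximal_maximizer {R : realType} {d} (H : set ('rV[R]_d * R)) y (lam a b : R) :
  closed H -> H !=set0 -> 0 < lam -> 0 <= b ->
  (forall p, H p -> p.2 <= a + b * `|p.1|) ->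
  exists2 p, H p & forall q, H q ->
    q.2 - dot q.1 y - lam / 2 * dot q.1 q.1 <=
    p.2 - dot p.1 y - lam / 2 * dot p.1 p.1.
Proof.
move=> clH [p0 Hp0] lam0 b0 growth.
pose g (q : 'rV[R]_d * R) := q.2 - dot q.1 y - lam / 2 * dot q.1 q.1.
have cfst : continuous (fst : 'rV[R]_d * R -> 'rV[R]_d) by move=> p; exact: cvg_fst.
have cg : continuous g.
  move=> p; apply: cvgB; last first.
    by apply: cvgMr; exact: (continuous_dot _ _ cfst cfst).
  apply: cvgB; first exact: cvg_snd.
  by apply: (continuous_dot fst (fun=> y) cfst) => ?; exact: cvg_cst.
pose L := H `&` [set p | g p0 <= g p].
have clL : closed L.
  apply: closedI => //.
  by apply: (@preimage_closed _ _ g [set r | g p0 <= r]) => [p _|]; [exact: cg|exact: closed_ge].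
pose Y := \sum_i `|y 0 i|.
have Y0 : 0 <= Y by exact: sumr_ge0.
pose A := `|a| + `|g p0|.
(* On [L] the norm [r] satisfies [lam / 2 * r ^+ 2 <= A + (b + Y) * r]. If [r > 1], then
   [A <= A * r], and dividing by [r] gives [r <= 2 * (A + (b + Y)) / lam]; the summand 1 covers the
   other case. *)
pose M := 1 + 2 * (A + (b + Y)) / lam.
have dY (x : 'rV[R]_d) : - (`|x| * Y) <= dot x y <= `|x| * Y.
  by rewrite -ler_norml; exact: dot_le_norm.
have A0 : 0 <= A by rewrite addr_ge0.
have boundx p : L p -> `|p.1| <= M.
  case=> /growth pab; rewrite /= {2}/g => gp.
  have /andP[dot1 dot2] := dY p.1.
  have sq := sqr_norm_le_dot p.1.
  have n0 := normr_ge0 p.1; set r := `|p.1| in n0 sq pab dot1 dot2 *.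
  have : lam / 2 * r ^+ 2 <= A + (b + Y) * r.
    have : lam / 2 * r ^+ 2 <= lam / 2 * dot p.1 p.1 by rewrite ler_pM2l// divr_gt0.
    have := ler_norm a; have := ler_norm (- g p0); rewrite normrN /A; lra.
  move=> quad; rewrite leNgt; apply/negP => rM.
  have r1 : 1 < r by apply: le_lt_trans rM; rewrite lerDl divr_ge0 ?(ltW lam0)// mulr_ge0// !addr_ge0.
  have : 2 * (A + (b + Y)) < lam * r.
    rewrite [lam * r]mulrC -ltr_pdivrMr//.
    by apply: lt_trans rM; rewrite /M ltrDr.
  have : A <= A * r by rewrite ler_peMr// ltW.
  nra.
have boundt p : L p -> p.2 \in `[g p0 - M * Y, a + b * M].
  move=> Lp; have rM := boundx _ Lp; case: Lp => /growth pab; rewrite /= {2}/g => gp.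
  have /andP[dot1 dot2] := dY p.1; have D0 := dot_ge0 p.1.
  rewrite in_itv/=; apply/andP; split.
    have : `|p.1| * Y <= M * Y by rewrite ler_wpM2r.
    have : 0 <= lam / 2 * dot p.1 p.1 by rewrite mulr_ge0// divr_ge0// ltW.
    lra.
  by apply: le_trans pab _; rewrite lerD2l ler_wpM2l.
have cptL : compact L.
  apply: (subclosed_compact clL (B := [set x | `|x| <= M] `*` `[g p0 - M * Y, a + b * M])).
    apply: compact_setX; last exact: segment_compact.
    apply: bounded_closed_compact.
      exists M; split; first exact: num_real.
      by move=> N MN x /= xM; apply: le_trans xM (ltW MN).
    apply: (@preimage_closed _ _ (fun x : 'rV[R]_d => `|x|) [set r | r <= M]) => [x _|].
      exact: norm_continuous.
    exact: closed_le.
  by move=> p Lp; split; [exact: boundx|exact: boundt].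
have [||p + pmax] := compact_EVT_max (f := g) _ cptL.
- by exists p0; split => //; exact: lexx.
- exact: continuous_subspaceT.
rewrite inE => -[Hp gp]; exists p => // q Hq.
have [gq|/ltW gq] := leP (g p0) (g q); last exact: le_trans gq gp.
by apply: pmax; rewrite inE.
Qed.

(** The slope [y + lam *: p.1] is the gradient at [p.1] of the subtracted quadratic. If [q] lay
    above the affine function of this slope through [p] by [delta > 0], moving from [p] a fraction
    [t] towards [q] would change the objective by [t * delta - t ^+ 2 * C], which is positive for
    small [t]. *)
Lemma maximizer_supergradient {R : realType} {d} (U : 'rV[R]_d -> \bar R) y (lam : R) p :
  concave_fun U -> 0 < lam -> closure (hypograph U) p ->
  (forall q, closure (hypograph U) q ->
    q.2 - dot q.1 y - lam / 2 * dot q.1 q.1 <=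
    p.2 - dot p.1 y - lam / 2 * dot p.1 p.1) ->
  superdifferential (usc_closure U) p.1 (y + lam *: p.1).
Proof.
move=> cU lam0 Hp pmax z.
pose z' := y + lam *: p.1.
have hyp q : hypograph U q -> q.2 - dot q.1 z' <= p.2 - dot p.1 z'.
  move=> Uq; rewrite leNgt; apply/negP => lt.
  have [v vE] : exists v, v = q.1 - p.1 by exists (q.1 - p.1).
  pose delta := q.2 - p.2 - dot v z'.
  have deltaE : delta = q.2 - p.2 - (dot v y + lam * dot p.1 v).
    by rewrite /delta /z' dotDr dotZr (dotC v p.1).
  pose C := lam / 2 * dot v v.
  have C0 : 0 <= C by rewrite mulr_ge0 ?dot_ge0// divr_ge0// ltW.
  have delta0 : 0 < delta by rewrite /delta vE dotBl; lra.
  have key t : 0 < t < 1 -> delta <= t * C.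
    move=> t01; have := pmax _ (closure_hypograph_mix _ _ _ _ cU t01 Hp Uq).
    have -> : (t *: q + (1 - t) *: p).1 = p.1 + t *: v.
      by rewrite vE/=; apply/rowP => i; rewrite !mxE; ring.
    have -> : (t *: q + (1 - t) *: p).2 = t * q.2 + (1 - t) * p.2 by [].
    rewrite !(dotDl, dotDr, dotZl, dotZr) (dotC v p.1) => le0.
    case/andP: t01 => t0 t1.
    rewrite -(ler_pM2l t0) deltaE /C; nra.
  have C10 : 0 < 1 + C + delta by rewrite addr_gt0// ltr_pwDl.
  (* This [t] is below 1 and makes [t * C] smaller than [delta]. *)
  have := key (delta / (1 + C + delta)); rewrite divr_gt0// ltr_pdivrMr// mul1r.
  have -> : delta < 1 + C + delta by rewrite ltrDr ltr_pwDl.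
  by move=> /(_ isT); rewrite mulrAC ler_pdivlMr//; nra.
have cl q : closure (hypograph U) q -> q.2 - dot q.1 z' <= p.2 - dot p.1 z'.
  move: q; apply: closure_sub_le hyp => q; apply: cvgB; first exact: cvg_snd.
  apply: (continuous_dot fst (fun=> z')) => ?; first exact: cvg_fst.
  exact: cvg_cst.
(* The affine bound holds with [p.2], which is at most [usc_closure U p.1]. *)
apply: (@le_trans _ _ (p.2 + dot (z - p.1) z')%:E).
  apply: ge_ereal_sup => _ [t /= /cl/= zt <-]; rewrite lee_fin dotBl; lra.
rewrite EFinD leeD2r//; apply: ereal_sup_ubound; exists p.2 => //=; rewrite -surjective_pairing.
Qed.

(** * The domain of the dual function and the polar cone *)

(** Trades extended-real arithmetic for real inequalities, which extend to the closed hypograph by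
    continuity. *)
Lemma vdom_dual_funP {R : realType} {d} (U : 'rV[R]_d -> \bar R) y :
  (forall x, (U x < +oo)%E) ->
  vdom (dual_fun U) y <->
  exists D, forall p, hypograph U p -> p.2 - dot p.1 y <= D.
Proof.
move=> Ufin; split => [Uy|[D UD]].
  have [D UyD] : exists D, (dual_fun U y <= D%:E)%E.
    by move: Uy; rewrite /vdom/=; case: (dual_fun U y) => // [D|] _; [exists D|exists 0; rewrite leNye].
  exists D => -[x t] /= Uxt; rewrite -lee_fin; apply: le_trans UyD.
  apply: (@le_trans _ _ (U x - (dot x y)%:E)%E); first by rewrite EFinB leeB.
  by apply: ereal_sup_ubound; exists x.
apply: (@le_lt_trans _ _ D%:E); last exact: ltry.
apply: ge_ereal_sup => _ [x _ <-].
have := Ufin x; case Ux: (U x) => [r| |]// _; rewrite ?leNye//.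
by rewrite -EFinB lee_fin; apply: (UD (x, r)); rewrite /hypograph/= Ux.
Qed.

(** A supergradient bounds [U] by an affine function of slope [y], provided [usc_closure U x] is not
    [+oo]; linear growth ensures this. *)
Lemma superdifferential_sub_vdom {R : realType} {d} (U : 'rV[R]_d -> \bar R) x y :
  utility_function U -> superdifferential (usc_closure U) x y -> vdom (dual_fun U) y.
Proof.
move=> hU xy; have [a [b [b0 growth]]] := utility_linear_growth _ hU.
case: hU => -[Ufin _ _] _ _ _ _.
apply/vdom_dual_funP => //; exists (a + b * `|x| - dot x y) => -[z t] Uzt /=.
have : (t%:E <= usc_closure U x + (dot (z - x) y)%:E)%E.
  apply: le_trans (xy z); apply: ereal_sup_ubound; exists t => //=.
  exact: subset_closure.
have : (usc_closure U x <= (a + b * `|x|)%:E)%E.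
  by apply: ge_ereal_sup => _ [s /= /growth xs <-]; rewrite lee_fin.
move=> ux /le_trans; move=> /(_ (a + b * `|x| + dot (z - x) y)%:E).
rewrite EFinD leeD2r// => /(_ isT); rewrite -EFinD lee_fin dotBl; lra.
Qed.

Lemma polar_cone_convex {R : realType} {d} (C : set 'rV[R]_d) : convex_cone (polar_cone C).
Proof.
move=> l m x y l0 m0 Cx Cy z Cz; rewrite dotDr !dotZr.
by rewrite addr_ge0// mulr_ge0// ?Cx ?Cy.
Qed.

Lemma closed_polar_cone {R : realType} {d} (C : set 'rV[R]_d) : closed (polar_cone C).
Proof.
move=> y cly x Cx; rewrite -oppr_le0.
have cx : continuous (fun z => - dot x z).
  have cdx : continuous (fun z : 'rV[R]_d => dot x z).
    by apply: (continuous_dot (fun=> x) idfun) => z; [exact: cst_continuous|apply: cvg_id].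
  by move=> z; exact: (continuousN (cdx z)).
by apply: (closure_sub_le _ 0 _ cx _ y cly) => z Cz; rewrite oppr_le0 Cz.
Qed.

(** By monotonicity [U] stays above [U x0] along the ray from [x0] in direction [k], so
    [dot k y < 0] would make the supremum defining the dual infinite. *)
Lemma vdom_sub_polar_cone {R : realType} {d} (U : 'rV[R]_d -> \bar R) :
  utility_function U -> vdom (dual_fun U) `<=` polar_cone (support_cone U).
Proof.
case=> -[Ufin _ [x0 x0U]] coneU _ _ mono y /(vdom_dual_funP U y Ufin)[D UD] k Uk.
have [s0 Us0] : exists s, U x0 = s%:E.
  by exists (fine (U x0)); rewrite fineK// fin_numE -ltNye x0U lt_eqF.
have bound n : 0 <= n -> s0 - (dot x0 y + n * dot k y) <= D.
  move=> n0; rewrite -dotZl -dotDl; apply: (UD (x0 + n *: k, s0)).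
  rewrite /hypograph/= -Us0; apply: mono; rewrite addrAC subrr add0r.
  by have := coneU _ _ _ _ n0 (lexx 0) Uk Uk; rewrite scale0r addr0.
have := bound 0 (lexx 0); rewrite mul0r addr0 => D0.
rewrite leNgt; apply/negP => ky; rewrite -oppr_gt0 in ky.
(* The multiple of [k] for which the bound reads [D + 1 <= D]. *)
have := bound ((D + 1 - (s0 - dot x0 y)) / - dot k y).
rewrite divr_ge0 ?(ltW ky)//; last lra.
by rewrite invrN mulrN mulNr divfK ?lt_eqF -?oppr_gt0// => /(_ isT); lra.
Qed.

(** Pairing with [k] is nonnegative on the domain of [U], so the same [D] serves for [y + k]. *)
Lemma vdom_add_polar_cone {R : realType} {d} (U : 'rV[R]_d -> \bar R) y k :
  utility_function U -> polar_cone (support_cone U) k ->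
  vdom (dual_fun U) y -> vdom (dual_fun U) (y + k).
Proof.
case=> -[Ufin _ _] _ _ _ _ Uk /(vdom_dual_funP U y Ufin)[D UD].
apply/vdom_dual_funP => //; exists D => p Up; have := UD _ Up.
have : 0 <= dot p.1 k.
  apply: Uk; apply: subset_closure; apply: lt_le_trans Up; exact: ltNyr.
rewrite dotDr; lra.
Qed.

(** * The cycle of implications *)

Theorem proposition2p15 (R : realType) (d : nat) (U : 'rV[R]_d -> \bar R)
    (hU : utility_function U) :
  [<-> asymptotically_satiable U;
       closure (vdom (dual_fun U)) (0 : 'rV[R]_d);
       closure (vdom (dual_fun U)) = polar_cone (support_cone U);
       convex_cone (closure (vdom (dual_fun U)))].
Proof.
have dom_polar : closure (vdom (dual_fun U)) `<=` polar_cone (support_cone U).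
  rewrite [X in _ `<=` X]((closure_id _).1 (closed_polar_cone _)).
  exact: closureS (vdom_sub_polar_cone U hU).
have [a [b [b0 growth]]] := utility_linear_growth U hU.
have [[Ufin cU [x0 x0U]] coneU orth _ _] := hU.
pose s0 := fine (U x0).
have Us0 : hypograph U (x0, s0) by rewrite /hypograph/= fineK// fin_numE -ltNye x0U lt_eqF.
have prox y (lam : R) (lam0 : 0 < lam) :=
  proximal_maximizer (closure (hypograph U)) y lam a b (@closed_closure _ _)
    (ex_intro _ _ (subset_closure Us0)) lam0 b0 growth.
tfae.
- move=> sat B /nbhs_ballP[e /= e0 eB].
  have [x [y [xy ye]]] := sat _ e0.
  exists y; split; first exact: superdifferential_sub_vdom xy.
  apply: eB; split => // i j; rewrite (ord1 i) /ball/= mxE sub0r normrN.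
  by have /andP[y0 ylt] := ye j; rewrite ger0_norm.
- move=> cl0; apply/seteqP; split => // k Uk; rewrite -[k]add0r.
  have ck : continuous (fun y : 'rV[R]_d => y + k).
    by move=> y; exact: (continuousD (@cvg_id _ _) (@cst_continuous _ _ k y)).
  apply: (closure_sub_preimage _ _ _ ck _ 0 cl0) => y Uy.
  exact: vdom_add_polar_cone.
- by move=> ->; exact: polar_cone_convex.
- move=> cone e e0.
  (* The convex cone condition holds vacuously for the empty set. *)
  have [p1 Up1 pmax1] := prox 0 1 ltr01.
  have dom1 := superdifferential_sub_vdom _ _ _ hU
    (maximizer_supergradient _ _ _ _ cU ltr01 Up1 pmax1).
  have := cone 0 0 _ _ (lexx 0) (lexx 0) (subset_closure dom1) (subset_closure dom1).
  rewrite !scale0r addr0.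
  (* Zero coefficients have put 0 in the closure. Half of [e] bounds [y], the other half is kept for
     [lam *: p.1]. *)
  have e20 : 0 < e / 2 by rewrite divr_gt0.
  move=> /(_ _ (nbhsx_ballx 0 _ e20))[y [Uy]].
  rewrite mx_norm_ball /ball_/= sub0r normrN => ye.
  have /(vdom_dual_funP U y Ufin)[D UD] := Uy.
  (* Comparing the maximizer with [(x0, s0)] and bounding its linear part by [D] gives
     [lam * dot p.1 p.1 <= E] whenever [lam <= 1]. *)
  pose E := 2 * (D - (s0 - dot x0 y)) + dot x0 x0.
  have DE : s0 - dot x0 y <= D by exact: (UD _ Us0).
  have E0 : 0 <= E by rewrite addr_ge0 ?dot_ge0// mulr_ge0// subr_ge0.
  pose e2 := (e / 2) ^+ 2.
  have e20' : 0 < e2 by rewrite exprn_gt0.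
  have den0 : 0 < 1 + E + e2 by rewrite addr_gt0// ltr_pwDl.
  (* Chosen so that [lam <= 1] and [lam * E < e2]; then [lam ^+ 2 * dot p.1 p.1 < e2], so each entry
     of [lam *: p.1] is below [e / 2] in absolute value. *)
  pose lam := e2 / (1 + E + e2).
  have lam0 : 0 < lam by rewrite divr_gt0.
  have lam1 : lam <= 1 by rewrite ler_pdivrMr// mul1r lerDr addr_ge0.
  have lamE : lam * E < e2.
    by rewrite mulrAC ltr_pdivrMr// ltr_pM2l//; lra.
  have [p Up pmax] := prox y lam lam0.
  have sup := maximizer_supergradient _ _ _ _ cU lam0 Up pmax.
  exists p.1, (y + lam *: p.1); split => // i.
  have pE : lam ^+ 2 * dot p.1 p.1 < e2.
    have pD : p.2 - dot p.1 y <= D.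
      move: (p) Up; apply: closure_sub_le UD => q; apply: cvgB; first exact: cvg_snd.
      apply: (continuous_dot fst (fun=> y)) => ?; first exact: cvg_fst.
      exact: cvg_cst.
    have /= pmax0 := pmax _ (subset_closure Us0).
    have lamx0 : lam * dot x0 x0 <= dot x0 x0 by rewrite ler_piMl// dot_ge0.
    have : lam * dot p.1 p.1 <= E by rewrite /E; lra.
    by rewrite -(ler_pM2l lam0) mulrA -expr2 => /le_lt_trans; apply.
  have pi : `|lam * p.1 0 i| < e / 2.
    rewrite -(ltr_pXn2r (n := 2))// ?nnegrE ?(ltW e20)// real_normK ?num_real//.
    apply: le_lt_trans pE; rewrite exprMn ler_pM2l ?exprn_gt0//.
    exact: sqr_entry_le_dot.
  (* Nonnegativity: the supergradient lies in the polar cone, and its entries are its pairings with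
     unit vectors, which belong to the support cone. *)
  apply/andP; split.
    rewrite -dot_delta_mx; apply: dom_polar.
      by apply: subset_closure; exact: superdifferential_sub_vdom sup.
    by apply: orth => j; rewrite mxE ler0n.
  have yi := le_lt_trans (entry_le_norm y i) ye.
  rewrite !mxE; move: yi pi; rewrite !ltr_norml => /andP[_ ?] /andP[_ ?]; lra.
Qed.
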